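(* Let $C,\gamma>0$. There exist constants $C_{\rm LU}>0$ and $p>2$ (depending only on $C,\gamma$) such that for all $n,m\in\mathbb{N}$, every block structure $0=n_0<n_1<\dots<n_m=n$ and every $M\in\mathbb{R}^{n\times n}$ with $\|M\|_{S_\infty}\le C$ and $\max_{0\le j\le m-1}\|(M[j])^{-1}\|_{S_\infty}\le1/\gamma$, $M$ has a normalized block-$LU$-factorization $M=LU$ satisfying $$\|L\|_{S_\infty}+\|U\|_{S_\infty}+\|L^{-1}\|_{S_\infty}+\|U^{-1}\|_{S_\infty}\le C_{\rm LU}\,m^{1/p}.$$
   Context: Block $(i,j)$, $0\le i,j\le m-1$, consists of rows $n_i+1..n_{i+1}$ and columns $n_j+1..n_{j+1}$. $M[j]:=M(0{:}j,0{:}j)\in\mathbb{R}^{n_{j+1}\times n_{j+1}}$ is the restriction of $M$ to the first $j+1$ block rows and block columns. A normalized block-$LU$-factorization is $M=LU$ with $L$ block lower triangular with identity diagonal blocks ($L(i,j)=0$ for $j>i$, $L(i,i)=I$) and $U$ block upper triangular ($U(j,i)=0$ for $j>i$). $\|\cdot\|_{S_\infty}$ is the spectral norm. *)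

(* Defs.v *)
From HB Require Import structures.
From mathcomp Require Import all_boot all_order all_algebra.
From mathcomp Require Import all_classical all_reals all_analysis.
Set Implicit Arguments. Unset Strict Implicit. Unset Printing Implicit Defensive.
Import Order.TTheory GRing.Theory Num.Theory.
Local Open Scope classical_set_scope.
Local Open Scope ring_scope.

Section Defs.
Variable R : realType.

Definition vnorm2 {k : nat} (x : 'cV[R]_k) : R := Num.sqrt (\sum_i (x i ord0) ^+ 2).

Definition specnorm {a b : nat} (A : 'M[R]_(a, b)) : R :=
  sup [set vnorm2 (A *m x) | x in [set x : 'cV[R]_b | vnorm2 x <= 1]].

Definition mxget {n : nat} (M : 'M[R]_n) (i j : nat) : R :=
  match (insub i : option 'I_n), (insub j : option 'I_n) with
  | Some i', Some j' => M i' j'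
  | _, _ => 0
  end.

Definition leadmx {n : nat} (k : nat) (M : 'M[R]_n) : 'M[R]_k :=
  \matrix_(i < k, j < k) mxget M i j.

End Defs.

Definition block_structure (n m : nat) (nb : nat -> nat) : Prop :=
  nb 0%N = 0%N /\ nb m = n /\ (forall i, (i < m)%N -> (nb i < nb i.+1)%N).

(* block index of a (0-based) row/column index r: the i with nb i <= r < nb (i+1) *)
Definition blk (m : nat) (nb : nat -> nat) (r : nat) : nat :=
  (\sum_(1 <= k < m) ((nb k <= r)%N : nat))%N.

Definition block_lower_unit {R : realType} {n : nat} (m : nat) (nb : nat -> nat)
  (L : 'M[R]_n) : Prop :=
  forall i j : 'I_n,
    ((blk m nb i < blk m nb j)%N -> L i j = 0) /\
    (blk m nb i = blk m nb j -> L i j = (i == j)%:R).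

Definition block_upper {R : realType} {n : nat} (m : nat) (nb : nat -> nat)
  (U : 'M[R]_n) : Prop :=
  forall i j : 'I_n, (blk m nb j < blk m nb i)%N -> U i j = 0.

(* Main.v *)
(** The columns of [U^-1] (and those of [L^-T]) form a basic sequence: its
    partial-sum projections are the Galerkin projections onto the leading block
    coordinates, of norm at most [K = C / gamma].  So for [y1], [y2] in the spans
    of two consecutive groups of block columns, [|y1 - y2|] dominates both norms
    up to a constant, and the parallelogram identity gives
    [|y1 + y2|^2 <= theta (|y1|^2 + |y2|^2)] with [theta < 2] depending on [K]
    only.  Dyadic grouping of the [m] blocks yields norm growth of order
    [theta^(log2 m / 2) = m^(a/2)] with [a = log2 theta < 1], that is, [p = 2/a].
    Finally [L = M U^-1] and [U = L^-1 M]. *)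

Require Import Defs.
From HB Require Import structures.
From mathcomp Require Import all_boot all_order all_algebra.
From mathcomp Require Import all_classical all_reals all_analysis.
From mathcomp Require Import ring lra.
Import Order.TTheory GRing.Theory Num.Theory.
Local Open Scope ring_scope.

(** * Euclidean and spectral norms, handled in squared form *)

Section SquaredNorm.
Set Implicit Arguments. Unset Strict Implicit.
Variable R : realType.

Definition dotv {n : nat} (x y : 'cV[R]_n) : R := (x^T *m y) ord0 ord0.

Definition nsq {n : nat} (x : 'cV[R]_n) : R := dotv x x.

(** Here [c] bounds the squared operator norm, so estimates stay polynomial and free of square
    roots. *)
Definition sqbound {a b : nat} (A : 'M[R]_(a, b)) (c : R) : Prop :=
  forall x, nsq (A *m x) <= c * nsq x.

Lemma dotvDl n (x y z : 'cV[R]_n) : dotv (x + y) z = dotv x z + dotv y z.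
Proof. by rewrite /dotv linearD /= mulmxDl mxE. Qed.

Lemma dotvDr n (x y z : 'cV[R]_n) : dotv z (x + y) = dotv z x + dotv z y.
Proof. by rewrite /dotv mulmxDr mxE. Qed.

Lemma dotvZl n a (x z : 'cV[R]_n) : dotv (a *: x) z = a * dotv x z.
Proof. by rewrite /dotv linearZ /= -scalemxAl mxE. Qed.

Lemma dotvZr n a (x z : 'cV[R]_n) : dotv z (a *: x) = a * dotv z x.
Proof. by rewrite /dotv -scalemxAr mxE. Qed.

Lemma dotvC n (x y : 'cV[R]_n) : dotv x y = dotv y x.
Proof. by rewrite /dotv !mxE; apply: eq_bigr => i _; rewrite !mxE mulrC. Qed.

Lemma dotv_tr m n (A : 'M[R]_(m, n)) (x : 'cV[R]_n) (y : 'cV[R]_m) :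
  dotv (A *m x) y = dotv x (A^T *m y).
Proof. by rewrite /dotv trmx_mul mulmxA. Qed.

Lemma nsqE n (x : 'cV[R]_n) : nsq x = \sum_i (x i ord0) ^+ 2.
Proof.
by rewrite /nsq /dotv mxE; apply: eq_bigr => i _; rewrite !mxE expr2.
Qed.

Lemma nsq_ge0 n (x : 'cV[R]_n) : 0 <= nsq x.
Proof. by rewrite nsqE; apply: sumr_ge0 => i _; exact: sqr_ge0. Qed.

Lemma nsqZ n a (x : 'cV[R]_n) : nsq (a *: x) = a ^+ 2 * nsq x.
Proof. by rewrite /nsq dotvZl dotvZr mulrA expr2. Qed.

Lemma nsq0 n : nsq (0 : 'cV[R]_n) = 0.
Proof. by rewrite /nsq /dotv mulmx0 mxE. Qed.

Lemma nsq_col0 (x : 'cV[R]_0) : nsq x = 0.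
Proof. by rewrite nsqE big_ord0. Qed.

Lemma nsqD n (x y : 'cV[R]_n) : nsq (x + y) = nsq x + 2 * dotv x y + nsq y.
Proof. by rewrite /nsq !dotvDl !dotvDr (dotvC y x); ring. Qed.

Lemma nsqB n (x y : 'cV[R]_n) : nsq (x - y) = nsq x - 2 * dotv x y + nsq y.
Proof. by rewrite -scaleN1r nsqD nsqZ dotvZr; ring. Qed.

Lemma parallelogram n (x y : 'cV[R]_n) :
  nsq (x + y) + nsq (x - y) = 2 * (nsq x + nsq y).
Proof. by rewrite nsqD nsqB; ring. Qed.

Lemma nsq_eq0 n (x : 'cV[R]_n) : nsq x = 0 -> x = 0.
Proof.
rewrite nsqE => /eqP; rewrite psumr_eq0; last by move=> i _; exact: sqr_ge0.
move=> /allP h; apply/colP => i; rewrite mxE.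
by have := h i (mem_index_enum _); rewrite sqrf_eq0 => /eqP.
Qed.

Lemma dotv_AMGM n (c : R) (x y : 'cV[R]_n) :
  2 * c * dotv x y <= c ^+ 2 * nsq x + nsq y.
Proof. by have := nsq_ge0 (c *: x - y); rewrite nsqB nsqZ dotvZl; lra. Qed.

Lemma CauchySchwarz_nsq n (x y : 'cV[R]_n) : dotv x y ^+ 2 <= nsq x * nsq y.
Proof.
have [/nsq_eq0 ->|x0] := eqVneq (nsq x) 0.
  by rewrite nsq0 mul0r /dotv trmx0 mul0mx mxE expr0n.
have px : 0 < nsq x by rewrite lt_def x0 nsq_ge0.
have := nsq_ge0 (dotv x y *: x - nsq x *: y).
rewrite nsqB !nsqZ dotvZl dotvZr => h.
by rewrite -(ler_pM2l px); nra.
Qed.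

Lemma sqboundM a b d (A : 'M[R]_(a, b)) (B : 'M[R]_(b, d)) c c' : 0 <= c ->
  sqbound A c -> sqbound B c' -> sqbound (A *m B) (c * c').
Proof.
move=> c0 hA hB x; rewrite -mulmxA; apply: (le_trans (hA _)).
by rewrite -mulrA; apply: ler_wpM2l.
Qed.

(** AM-GM on [x] and [A *m (A^T *m x)] gives [2c|A^T x|^2 <= c^2|x|^2 + |A A^T x|^2]. The last term
    is at most [c|A^T x|^2]; absorb it on the left and divide by [c]. *)
Lemma sqbound_tr a b (A : 'M[R]_(a, b)) c : 0 < c ->
  sqbound A c -> sqbound A^T c.
Proof.
move=> c0 hA x; have := hA (A^T *m x).
have := dotv_AMGM c x (A *m (A^T *m x)).
rewrite dotvC dotv_tr -/(nsq (A^T *m x)).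
set s := nsq (A^T *m x); set t := nsq (A *m _) => h1 h2.
by rewrite -(ler_pM2l c0); lra.
Qed.

Lemma vnorm2E n (x : 'cV[R]_n) : vnorm2 x = Num.sqrt (nsq x).
Proof. by rewrite nsqE. Qed.

Lemma vnorm2_ge0 n (x : 'cV[R]_n) : 0 <= vnorm2 x.
Proof. exact: sqrtr_ge0. Qed.

Lemma vnorm2_sqr n (x : 'cV[R]_n) : vnorm2 x ^+ 2 = nsq x.
Proof. by rewrite vnorm2E sqr_sqrtr // nsq_ge0. Qed.

Lemma sqbound_vnorm2 a b (A : 'M[R]_(a, b)) c x : 0 <= c ->
  sqbound A (c ^+ 2) -> vnorm2 (A *m x) <= c * vnorm2 x.
Proof.
move=> c0 hA; rewrite -(@ler_pXn2r _ 2) ?nnegrE ?vnorm2_ge0 ?mulr_ge0 ?vnorm2_ge0//.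
by rewrite exprMn !vnorm2_sqr.
Qed.

Lemma specnorm_le a b (A : 'M[R]_(a, b)) c : 0 <= c ->
  sqbound A (c ^+ 2) -> specnorm A <= c.
Proof.
move=> c0 hA; apply: ge_sup.
  by exists (vnorm2 (A *m 0)); exists 0 => //=; rewrite vnorm2E nsq0 sqrtr0.
move=> _ [x /= hx <-]; apply: (le_trans (sqbound_vnorm2 _ c0 hA)).
by rewrite -[leRHS]mulr1; apply: ler_wpM2l.
Qed.

(** A Frobenius bound, by Cauchy-Schwarz on each row. It makes the set in [specnorm] bounded above,
    so that its [sup] is a genuine supremum. *)
Lemma sqbound_exists a b (A : 'M[R]_(a, b)) :
  exists2 c, 0 <= c & sqbound A (c ^+ 2).
Proof.
pose S := \sum_i nsq (row i A)^T.
have S0 : 0 <= S by apply: sumr_ge0 => i _; exact: nsq_ge0.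
(* Since [S <= (1 + S)^2], this choice spares a square root. *)
exists (1 + S); first by rewrite addr_ge0.
move=> x; apply: (@le_trans _ _ (S * nsq x)).
  rewrite nsqE mulr_suml; apply: ler_sum => i _.
  suff -> : (A *m x) i ord0 = dotv (row i A)^T x by exact: CauchySchwarz_nsq.
  by rewrite /dotv trmxK -row_mul [RHS]mxE.
by rewrite ler_wpM2r ?nsq_ge0 //; nra.
Qed.

Lemma vnorm2_le_specnorm a b (A : 'M[R]_(a, b)) x :
  vnorm2 x <= 1 -> vnorm2 (A *m x) <= specnorm A.
Proof.
move=> hx; have [B B0 hB] := sqbound_exists A.
apply: ub_le_sup; last by exists x.
exists B => _ [y /= hy <-]; apply: (le_trans (sqbound_vnorm2 _ B0 hB)).
by rewrite -[leRHS]mulr1; apply: ler_wpM2l.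
Qed.

Lemma sqbound_specnorm a b (A : 'M[R]_(a, b)) c :
  specnorm A <= c -> sqbound A (c ^+ 2).
Proof.
move=> hA x.
have hub y : vnorm2 y <= 1 -> vnorm2 (A *m y) <= c.
  by move=> hy; apply: le_trans hA; exact: vnorm2_le_specnorm.
 have [x0|x0] := eqVneq (nsq x) 0.
  by rewrite (nsq_eq0 x0) mulmx0 !nsq0 mulr0.
have v0 : 0 < vnorm2 x by rewrite vnorm2E sqrtr_gt0 lt_def x0 nsq_ge0.
have hv : vnorm2 ((vnorm2 x)^-1 *: x) <= 1.
  rewrite -(@ler_pXn2r _ 2) ?nnegrE ?vnorm2_ge0// vnorm2_sqr nsqZ exprVn.
  by rewrite vnorm2_sqr mulVf// expr1n.
have c0 : 0 <= c := le_trans (vnorm2_ge0 _) (hub _ hv).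
have := hub _ hv; rewrite -(@ler_pXn2r _ 2) ?nnegrE ?vnorm2_ge0// vnorm2_sqr.
rewrite -scalemxAr nsqZ exprVn vnorm2_sqr mulrC ler_pdivrMr//.
by rewrite lt_def x0 nsq_ge0.
Qed.

Lemma specnorm_ge0 a b (A : 'M[R]_(a, b)) : 0 <= specnorm A.
Proof.
apply: (le_trans (vnorm2_ge0 (A *m 0))); apply: vnorm2_le_specnorm.
by rewrite vnorm2E nsq0 sqrtr0.
Qed.

Lemma specnormM a b d (A : 'M[R]_(a, b)) (B : 'M[R]_(b, d)) c c' :
  specnorm A <= c -> specnorm B <= c' -> specnorm (A *m B) <= c * c'.
Proof.
move=> hA hB; have c0 := le_trans (specnorm_ge0 A) hA.
have c'0 := le_trans (specnorm_ge0 B) hB.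
apply: specnorm_le; rewrite ?mulr_ge0// exprMn.
by apply: sqboundM; rewrite ?sqr_ge0//; exact: sqbound_specnorm.
Qed.

End SquaredNorm.

(** * Dyadic norm growth for basic sequences *)

Section BasicSequences.
Set Implicit Arguments. Unset Strict Implicit.
Variable R : realType.

Definition trunc {n} (b : 'I_n -> nat) (k : nat) (x : 'cV[R]_n) : 'cV[R]_n :=
  \col_i (if (b i < k)%N then x i ord0 else 0).

Lemma nsq_trunc n (b : 'I_n -> nat) k x :
  nsq x = nsq (trunc b k x) + nsq (x - trunc b k x).
Proof.
rewrite !nsqE -big_split /=; apply: eq_bigr => i _; rewrite !mxE.
by case: ifP => _; ring.
Qed.

(* The truncation bound says that the two halves of a sum make a definite angle,
   so the parallelogram identity improves the trivial factor 2 to 2 - 1/N. *)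
Lemma dyadic_sqbound n (A : 'M[R]_n) (b : 'I_n -> nat) (K2 c : R) :
  0 <= K2 ->
  (forall k (x : 'cV_n), nsq (A *m trunc b k x) <= K2 * nsq (A *m x)) ->
  (forall k (x : 'cV_n), (forall i, b i != k -> x i ord0 = 0) ->
     nsq (A *m x) <= c * nsq x) ->
  forall l a (x : 'cV_n), (forall i, x i ord0 != 0 -> (a <= b i < a + 2 ^ l)%N) ->
  nsq (A *m x) <= (2 - (3 * K2 + 2)^-1) ^+ l * c * nsq x.
Proof.
move=> K0 hT hB; set N := 3 * K2 + 2.
have N0 : 0 < N by rewrite /N; lra.
have N1 : N^-1 <= 1 by rewrite invf_le1 /N//; lra.
elim=> [|l IH] a x hx.
  rewrite expr0 mul1r; apply: (hB a) => i hi; apply/eqP.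
  by apply: contraNT hi => /hx; rewrite expn0 addn1 ltnS eqn_leq andbC.
(* Split the window of [2 ^ l.+1] groups at its midpoint. *)
set k := (a + 2 ^ l)%N; pose x1 := trunc b k x; pose x2 := x - x1.
have h1 : nsq (A *m x1) <= (2 - N^-1) ^+ l * c * nsq x1.
  apply: (IH a) => i; rewrite mxE; case: ifP => [bk /hx /andP[-> _] //|].
  by rewrite eqxx.
have h2 : nsq (A *m x2) <= (2 - N^-1) ^+ l * c * nsq x2.
  apply: (IH k) => i; rewrite !mxE; case: ifP => [_|bk]; rewrite ?subrr ?eqxx//.
  rewrite subr0 => /hx /andP[_]; rewrite expnS mul2n -addnn addnA -/k => ->.
  by rewrite leqNgt bk.
(* Flipping the sign of [x2] leaves the truncation unchanged, so [hT] bounds [A *m x1] by the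
   difference of the two halves. *)
have e1 : x1 = trunc b k (x1 - x2).
  by apply/colP => i; rewrite !mxE; case: ifP => // _; ring.
have h3 : nsq (A *m x1) <= K2 * nsq (A *m x1 - A *m x2).
  by rewrite {1}e1 -mulmxBr.
have := parallelogram (A *m x1) (A *m x2).
have := parallelogram (A *m x1) (A *m x1 - A *m x2).
have -> : A *m x1 - (A *m x1 - A *m x2) = A *m x2 by rewrite opprB addrC subrK.
have -> : A *m x1 + A *m x2 = A *m x by rewrite -mulmxDr /x2 [x1 + _]addrC subrK.
rewrite (nsq_trunc b k x) -/x1 -/x2 exprS.
move: h3; set d := nsq (A *m x1 - A *m x2) => h3 h5 h4.
(* Origin of [N]: [|A x2|^2 <= 2|A x1|^2 + 2d], so the sum is at most
   [3|A x1|^2 + 2d <= (3 K2 + 2) d]. *)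
have h6 : nsq (A *m x1) + nsq (A *m x2) <= N * d.
  by have := nsq_ge0 (A *m x1 + (A *m x1 - A *m x2)); rewrite /N; lra.
have h7 : N^-1 * (nsq (A *m x1) + nsq (A *m x2)) <= d.
  by rewrite ler_pdivrMl.
have N2 : 0 <= 2 - N^-1 by lra.
rewrite -!mulrA; apply: (@le_trans _ _ ((2 - N^-1) * (nsq (A *m x1) + nsq (A *m x2)))).
  by lra.
by apply: ler_wpM2l => //; lra.
Qed.

End BasicSequences.

(** * Leading coordinates, coercivity and Galerkin inverses *)

Section LeadingBlocks.
Set Implicit Arguments. Unset Strict Implicit.
Variable R : realType.

Definition emb (n s : nat) : 'M[R]_(n, s) := \matrix_(i, j) ((i : nat) == j)%:R.

Section Emb.
Variables (n s : nat) (hs : (s <= n)%N).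
Local Notation J := (emb n s).

Lemma emb_trM p (B : 'M[R]_(n, p)) i j : (J^T *m B) i j = B (widen_ord hs i) j.
Proof.
rewrite mxE (bigD1 (widen_ord hs i)) //= !mxE eqxx mul1r big1 ?addr0// => k hk.
rewrite !mxE [_ == _](_ : _ = false) ?mul0r//.
by apply/negbTE; apply: contra hk => /eqP hk; apply/eqP/val_inj.
Qed.

Lemma mulmx_emb p (B : 'M[R]_(p, n)) i j : (B *m J) i j = B i (widen_ord hs j).
Proof.
by rewrite -[B *m J]trmxK trmx_mul mxE emb_trM mxE.
Qed.

Lemma emb_out p (B : 'M[R]_(s, p)) (i : 'I_n) j : (s <= i)%N -> (J *m B) i j = 0.
Proof.
move=> hi; rewrite mxE big1// => k _; rewrite mxE [_ == _](_ : _ = false) ?mul0r//.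
by apply/negbTE; rewrite neq_ltn (leq_trans (ltn_ord k) hi) orbT.
Qed.

Lemma tr_emb_out p (B : 'M[R]_(p, s)) i (j : 'I_n) : (s <= j)%N -> (B *m J^T) i j = 0.
Proof. by move=> hj; rewrite -[B *m _]trmxK trmx_mul trmxK mxE emb_out. Qed.

Lemma emb_orth : J^T *m J = 1%:M.
Proof.
by apply/matrixP => i j; rewrite emb_trM !mxE.
Qed.

Lemma emb_trK p (B : 'M[R]_(n, p)) : (forall (i : 'I_n) j, (s <= i)%N -> B i j = 0) ->
  J *m (J^T *m B) = B.
Proof.
move=> hB; apply/matrixP => i j; have [hi|hi] := leqP s i.
  by rewrite emb_out // hB.
have -> : i = widen_ord hs (Ordinal hi) by exact: val_inj.
by rewrite -!emb_trM [J^T *m (J *m _)]mulmxA emb_orth mul1mx.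
Qed.

Lemma nsq_emb (w : 'cV[R]_s) : nsq (J *m w) = nsq w.
Proof. by rewrite /nsq dotv_tr mulmxA emb_orth mul1mx. Qed.

(** Pythagoras: [J *m J^T] is an orthogonal projection and [J] is an isometry. *)
Lemma nsq_emb_tr (v : 'cV[R]_n) : nsq (J^T *m v) <= nsq v.
Proof.
have := nsq_ge0 (v - J *m (J^T *m v)).
by rewrite nsqB nsq_emb dotvC dotv_tr -/(nsq _); lra.
Qed.

Lemma leadmx_emb (M : 'M[R]_n) : leadmx s M = J^T *m M *m J.
Proof.
apply/matrixP => i j; rewrite mulmx_emb emb_trM mxE /mxget.
have hi : (i < n)%N := leq_trans (ltn_ord i) hs.
have hj : (j < n)%N := leq_trans (ltn_ord j) hs.
rewrite !insubT; congr (M _ _); exact: val_inj.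
Qed.

(** A discrete inf-sup condition: the bound on the inverse of the leading block, phrased without the
    inverse. *)
Definition coercive_at (g2 : R) (M : 'M[R]_n) : Prop :=
  forall y : 'cV[R]_s, nsq y <= g2 * nsq (J^T *m M *m J *m y).

Lemma coercive_supp g2 M (z : 'cV[R]_n) : coercive_at g2 M ->
  (forall i : 'I_n, (s <= i)%N -> z i ord0 = 0) ->
  nsq z <= g2 * nsq (J^T *m (M *m z)).
Proof.
move=> hM hz; have e : J *m (J^T *m z) = z.
  by apply: emb_trK => i j; rewrite (ord1 j); exact: hz.
by have := hM (J^T *m z); rewrite -nsq_emb e -!mulmxA e.
Qed.

Lemma coercive_inv g2 M : J^T *m M *m J \in unitmx ->
  sqbound (invmx (J^T *m M *m J)) g2 -> coercive_at g2 M.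
Proof. by move=> hu hb y; have := hb (J^T *m M *m J *m y); rewrite mulKmx. Qed.

Lemma coercive_inv_tr g2 M : 0 < g2 -> J^T *m M *m J \in unitmx ->
  sqbound (invmx (J^T *m M *m J)) g2 -> coercive_at g2 M^T.
Proof.
move=> g0 hu hb; have e : (J^T *m M *m J)^T = J^T *m M^T *m J.
  by rewrite !trmx_mul trmxK mulmxA.
apply: coercive_inv; rewrite -e ?unitmx_tr// -trmx_inv.
exact: sqbound_tr.
Qed.

(** The leading inverse padded with zeros. When the leading block is invertible, [galerkin M *m M]
    is the Galerkin projection onto the first [s] coordinates. *)
Definition galerkin (M : 'M[R]_n) : 'M[R]_n :=
  J *m invmx (J^T *m M *m J) *m J^T.

Lemma galerkin_outl M (i j : 'I_n) : (s <= i)%N -> galerkin M i j = 0.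
Proof. by move=> hi; rewrite /galerkin -mulmxA emb_out. Qed.

Lemma galerkin_outr M p (B : 'M[R]_(p, n)) i (j : 'I_n) :
  (s <= j)%N -> (B *m galerkin M) i j = 0.
Proof. by move=> hj; rewrite /galerkin mulmxA tr_emb_out. Qed.

Lemma mul_galerkin M (i j : 'I_n) : J^T *m M *m J \in unitmx -> (i < s)%N ->
  (M *m galerkin M) i j = (i == j)%:R.
Proof.
move=> hu hi; have -> : i = widen_ord hs (Ordinal hi) by exact: val_inj.
rewrite -emb_trM /galerkin !mulmxA mulmxV// mul1mx !mxE.
by rewrite eq_sym.
Qed.

Lemma galerkin_mul M p (B : 'M[R]_(p, n)) i (j : 'I_n) :
  J^T *m M *m J \in unitmx -> (j < s)%N -> (B *m (galerkin M *m M)) i j = B i j.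
Proof.
move=> hu hj; have -> : j = widen_ord hs (Ordinal hj) by exact: val_inj.
rewrite -!mulmx_emb; congr (fun_of_matrix _ i _).
by rewrite /galerkin -!mulmxA [J^T *m (M *m J)]mulmxA mulVmx// mulmx1.
Qed.

End Emb.
End LeadingBlocks.

(** * Block indices and block boundaries *)

Section BlockIndex.
Set Implicit Arguments. Unset Strict Implicit.
Variables (n m : nat) (nb : nat -> nat).
Hypothesis hnb : block_structure n m nb.

Lemma nb_mono i j : (i <= j <= m)%N -> (nb i <= nb j)%N.
Proof.
have [_ [_ h]] := hnb; elim: j => [|j IH] /andP[ij jm].
  by move: ij; rewrite leqn0 => /eqP ->.
move: ij; rewrite leq_eqVlt => /orP[/eqP -> //|ij].
by apply: leq_trans (ltnW (h _ jm)); apply: IH; rewrite -ltnS ij ltnW.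
Qed.

Lemma nb_le k : (k <= m)%N -> (nb k <= n)%N.
Proof. by have [_ [<- _]] := hnb => km; apply: nb_mono; rewrite km leqnn. Qed.

(** [blk] counts the interior boundaries that are at most [r]; by monotonicity these form an initial
    run, so the count locates [r]. *)
Lemma blk_ltE k r : (k <= m)%N -> (r < n)%N -> (blk m nb r < k)%N = (r < nb k)%N.
Proof.
have [nb0 [nbm h]] := hnb => km rn; rewrite /blk; apply/idP/idP.
  apply: contraTT; rewrite -!leqNgt => kr.
  (* The case [k = m] is excluded by [r < n = nb m], so boundary [k] does occur in the sum. *)
  have {}km : (k < m)%N.
    rewrite ltn_neqAle km andbT; apply: contraTneq kr => ->.
    by rewrite nbm -ltnNge.
  rewrite (big_cat_nat _ (n := k.+1)) //=; apply: leq_trans (leq_addr _ _).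
  rewrite big_nat_cond (eq_bigr (fun=> 1%N)) => [|i].
    by rewrite -big_nat_cond sum_nat_const_nat muln1 subn1.
  rewrite andbT ltnS => /andP[_ ik]; rewrite (leq_trans _ kr)//.
  by apply: nb_mono; rewrite ik ltnW.
move=> rk; have k0 : (0 < k)%N by case: k rk {km} => //; rewrite nb0.
rewrite (big_cat_nat _ (n := k)) //= [X in (_ + X)%N]big_nat_cond.
rewrite [X in (_ + X)%N]big1 => [|i]; last first.
  rewrite andbT => /andP[ki im]; apply/eqP; rewrite eqb0 -ltnNge.
  by apply: leq_trans rk _; apply: nb_mono; rewrite ki ltnW.
rewrite addn0; apply: (@leq_ltn_trans (\sum_(1 <= i < k) 1)%N).
  by apply: leq_sum => i _; exact: leq_b1.
by rewrite sum_nat_const_nat muln1 subn1 prednK.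
Qed.

Lemma blk_lt r : (r < n)%N -> (blk m nb r < m)%N.
Proof. by move=> rn; rewrite blk_ltE //; have [_ [-> _]] := hnb. Qed.

End BlockIndex.

(** * Norm bounds for block triangular bases *)

Section BlockTriangularBound.
Set Implicit Arguments. Unset Strict Implicit.
Variables (R : realType) (n m : nat) (nb : nat -> nat).
Hypothesis hnb : block_structure n m nb.
Local Notation b := (fun i : 'I_n => blk m nb i).

Lemma block_lower_supp (B : 'M[R]_n) k (x : 'cV[R]_n) (i : 'I_n) :
  (forall i j : 'I_n, (b i < b j)%N -> B i j = 0) ->
  (forall j, (b j < k)%N -> x j ord0 = 0) -> (b i < k)%N -> (B *m x) i ord0 = 0.
Proof.
move=> hB hx ik; rewrite mxE big1// => j _.
have [jk|jk] := ltnP (b j) k; first by rewrite hx ?mulr0.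
by rewrite hB ?mul0r// (leq_trans ik).
Qed.

Lemma block_upper_supp (B : 'M[R]_n) k (x : 'cV[R]_n) (i : 'I_n) :
  (forall i j : 'I_n, (b j < b i)%N -> B i j = 0) ->
  (forall j, (k <= b j)%N -> x j ord0 = 0) -> (k <= b i)%N -> (B *m x) i ord0 = 0.
Proof.
move=> hB hx ik; rewrite mxE big1// => j _.
have [jk|jk] := leqP k (b j); first by rewrite hx ?mulr0.
by rewrite hB ?mul0r// (leq_trans jk).
Qed.

(* [A *m trunc b k x] is the Galerkin approximation of [A *m x] in the span of
   the first [k] block coordinates, whence quasi-optimality. *)
Lemma galerkin_trunc_bound (A M : 'M[R]_n) (C2 g2 : R) :
  0 <= g2 -> sqbound M C2 ->
  (forall k, (k <= m)%N -> coercive_at (nb k) g2 M) ->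
  (forall i j : 'I_n, (b j < b i)%N -> A i j = 0) ->
  (forall i j : 'I_n, (b i < b j)%N -> (M *m A) i j = 0) ->
  forall k (x : 'cV_n), nsq (A *m trunc b k x) <= g2 * C2 * nsq (A *m x).
Proof.
move=> g0 hM hc hA hMA k x; wlog km : k / (k <= m)%N.
  move=> wlg; have [/wlg //|mk] := leqP k m.
  suff -> : trunc b k x = trunc b m x by exact: wlg.
  apply/colP => i; have im := blk_lt hnb (ltn_ord i).
  by rewrite !mxE im (leq_trans im (ltnW mk)).
have hs := nb_le hnb km.
apply: (le_trans (coercive_supp hs (hc _ km) _)) => [i hi|].
  apply: (@block_upper_supp A k) => //; last by rewrite leqNgt (blk_ltE hnb)// -leqNgt.
  by move=> j jk; rewrite mxE ltnNge jk.
rewrite -mulrA; apply: ler_wpM2l => //.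
(* As [M *m A] is block lower triangular, its first [k] block rows see only the first [k] blocks of
   [x]. *)
suff -> : (emb R n (nb k))^T *m (M *m (A *m trunc b k x)) =
          (emb R n (nb k))^T *m (M *m (A *m x)).
  exact: le_trans (nsq_emb_tr hs _) (hM _).
apply/eqP; rewrite -subr_eq0 -!mulmxBr; apply/eqP/colP => i.
rewrite (emb_trM hs) mulmxA [RHS]mxE; apply: (@block_lower_supp _ k) => //.
  by move=> j jk; rewrite !mxE jk subrr.
by rewrite (blk_ltE hnb km (ltn_ord _)) /=; exact: ltn_ord.
Qed.

Lemma block_basis_bound (A M : 'M[R]_n) (C2 g2 c : R) (l : nat) :
  0 <= g2 -> 0 <= C2 -> sqbound M C2 ->
  (forall k, (k <= m)%N -> coercive_at (nb k) g2 M) ->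
  (forall i j : 'I_n, (b j < b i)%N -> A i j = 0) ->
  (forall i j : 'I_n, (b i < b j)%N -> (M *m A) i j = 0) ->
  (forall k (x : 'cV_n), (k < m)%N -> (forall i, b i != k -> x i ord0 = 0) ->
     nsq (A *m x) <= c * nsq x) ->
  (m <= 2 ^ l)%N ->
  sqbound A ((2 - (3 * (g2 * C2) + 2)^-1) ^+ l * c).
Proof.
move=> g0 C0 hM hc hA hMA hB ml x.
apply: (@dyadic_sqbound _ _ A b _ _ _ _ _ l 0%N).
- by rewrite mulr_ge0.
- exact: galerkin_trunc_bound.
(* No coordinate has block index [m] or more, so such a [y] is zero. *)
- move=> k y hy; have [km|mk] := ltnP k m; first exact: (hB k).
  have -> : y = 0.
    apply/colP => i; rewrite mxE hy// neq_ltn (leq_trans _ mk)//.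
    exact: (blk_lt hnb).
  by rewrite mulmx0 !nsq0 mulr0.
- by move=> i _; rewrite add0n leq0n (leq_trans _ ml)// (blk_lt hnb).
Qed.

End BlockTriangularBound.

(** * Explicit inverses of the two factors *)

Section BlockLU.
Set Implicit Arguments. Unset Strict Implicit.
Variables (R : realType) (n m : nat) (nb : nat -> nat).
Hypothesis hnb : block_structure n m nb.
Variable M : 'M[R]_n.
Local Notation b := (fun i : 'I_n => blk m nb i).
Local Notation J k := (emb R n (nb k)).
Hypothesis unitM : forall k, (k <= m)%N -> (J k)^T *m M *m J k \in unitmx.

(** Block column [j] comes from the inverse of [M[j]], block [j] included (hence [.+1]); this makes
    [M *m lu_invU] unit block lower triangular. *)
Definition lu_invU : 'M[R]_n := \matrix_(i, j) galerkin (nb (b j).+1) M i j.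

(** Block Gaussian elimination in closed form: block row [i] uses only the strictly earlier blocks
    (no [.+1]), so that [lu_invL *m M] vanishes below the block diagonal. *)
Definition lu_invL : 'M[R]_n :=
  \matrix_(i, j) ((i == j)%:R - (M *m galerkin (nb (b i)) M) i j).

Local Notation V := lu_invU.
Local Notation W := lu_invL.

Lemma lu_invU_upper (i j : 'I_n) : (b j < b i)%N -> V i j = 0.
Proof.
move=> ji; rewrite mxE galerkin_outl//.
by rewrite leqNgt -(blk_ltE hnb) ?(blk_lt hnb)// -leqNgt.
Qed.

Lemma mul_lu_invU (i j : 'I_n) : (b i <= b j)%N -> (M *m V) i j = (i == j)%:R.
Proof.
move=> ij; have jm : (b j < m)%N by exact: (blk_lt hnb).
rewrite -(mul_galerkin (nb_le hnb jm) (M := M)) ?unitM//.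
  by rewrite !mxE; apply: eq_bigr => k _; rewrite mxE.
by rewrite -(blk_ltE hnb).
Qed.

Lemma lu_invL_lower_unit (i j : 'I_n) : (b i <= b j)%N -> W i j = (i == j)%:R.
Proof.
move=> ij; rewrite mxE galerkin_outr ?subr0//.
by rewrite leqNgt -(blk_ltE hnb) -?leqNgt// ltnW// (blk_lt hnb).
Qed.

Lemma lu_invL_mul (i j : 'I_n) : (b j < b i)%N -> (W *m M) i j = 0.
Proof.
move=> ji; have im : (b i <= m)%N by apply: ltnW; exact: (blk_lt hnb).
transitivity (((1%:M - M *m galerkin (nb (b i)) M) *m M) i j).
  by rewrite !mxE; apply: eq_bigr => k _; rewrite !mxE.
rewrite mulmxBl mul1mx mxE [X in _ + X]mxE -mulmxA.
rewrite (galerkin_mul (nb_le hnb im)) ?subrr ?unitM//.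
by rewrite -(blk_ltE hnb).
Qed.

(* Below the diagonal read the product as (W M) V, on and above it as W (M V). *)
Lemma lu_invL_invU : W *m M *m V = 1%:M.
Proof.
apply/matrixP => i j; rewrite [RHS]mxE; have [ij|ji] := leqP (b i) (b j).
  rewrite -mulmxA mxE (bigD1 i)//= lu_invL_lower_unit// eqxx mul1r mul_lu_invU//.
  rewrite big1 ?addr0// => k ki; have [ik|{}ki] := leqP (b i) (b k).
    by rewrite lu_invL_lower_unit// eq_sym (negbTE ki) mul0r.
  have kj := leq_trans ki ij; rewrite mul_lu_invU 1?ltnW//.
  by rewrite (_ : k == j = false) ?mulr0//; apply: contraTF kj => /eqP ->; rewrite ltnn.
rewrite (_ : i == j = false); last by apply: contraTF ji => /eqP ->; rewrite ltnn.
rewrite mxE big1// => k _; have [ki|ik] := ltnP (b k) (b i).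
  by rewrite lu_invL_mul ?mul0r.
by rewrite lu_invU_upper ?mulr0// (leq_trans ji).
Qed.

Variables (C2 g2 : R).
Hypotheses (C0 : 0 < C2) (g0 : 0 < g2) (boundM : sqbound M C2).
Hypothesis boundI :
  forall k, (k <= m)%N -> sqbound (invmx ((J k)^T *m M *m J k)) g2.

Let coM k (km : (k <= m)%N) : coercive_at (nb k) g2 M :=
  coercive_inv (unitM km) (boundI km).

Let coMT k (km : (k <= m)%N) : coercive_at (nb k) g2 M^T :=
  coercive_inv_tr g0 (unitM km) (boundI km).

Lemma lu_invU_bound l : (m <= 2 ^ l)%N ->
  sqbound V ((2 - (3 * (g2 * C2) + 2)^-1) ^+ l * g2).
Proof.
apply: (block_basis_bound hnb (M := M)) => //; rewrite ?ltW//.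
- exact: lu_invU_upper.
- move=> i j ij; rewrite mul_lu_invU 1?ltnW//.
  by rewrite (_ : i == j = false)//; apply: contraTF ij => /eqP ->; rewrite ltnn.
move=> k x km hx; have hs := nb_le hnb km.
apply: (le_trans (coercive_supp hs (coM km) _)) => [i hi|].
  apply: (block_upper_supp (m := m) (nb := nb) (k := k.+1)).
  - exact: lu_invU_upper.
  - by move=> j jk; apply: hx; rewrite neq_ltn jk orbT.
  - by rewrite leqNgt (blk_ltE hnb)// -leqNgt.
apply: ler_wpM2l; first exact: ltW.
(* On vectors living in block [k], the block rows up to [k] of [M *m V] act as the identity, which
   gives the single-block constant [g2]. *)
suff -> : (J k.+1)^T *m (M *m (V *m x)) = (J k.+1)^T *m x by exact: nsq_emb_tr.
apply/colP => i; rewrite !(emb_trM hs) mulmxA -[x in RHS]mul1mx [LHS]mxE [RHS]mxE.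
apply: eq_bigr => j _; have [jk|jk] := eqVneq (b j) k.
  congr (_ * _); rewrite mul_lu_invU ?[RHS]mxE// jk -ltnS.
  by rewrite (blk_ltE hnb km (ltn_ord _)) /=; exact: ltn_ord.
by rewrite hx ?mulr0.
Qed.

(** The argument for [V] applied to [W^T] and [M^T]: [W^T] is block upper triangular and
    [M^T *m W^T] is block lower triangular. *)
Lemma lu_invL_bound l : (m <= 2 ^ l)%N ->
  sqbound W ((2 - (3 * (g2 * C2) + 2)^-1) ^+ l * (2 * (1 + g2 * C2))).
Proof.
move=> ml; rewrite -[W]trmxK; apply: sqbound_tr.
  have p0 := mulr_gt0 g0 C0.
  have N1 : (3 * (g2 * C2) + 2)^-1 <= 1 by rewrite invf_le1; lra.
  by rewrite mulr_gt0 ?exprn_gt0//; lra.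
apply: (block_basis_bound hnb (M := M^T)) ml => //; rewrite ?ltW//.
- exact: sqbound_tr.
- move=> i j ij; rewrite mxE lu_invL_lower_unit 1?ltnW//.
  by rewrite (_ : j == i = false)//; apply: contraTF ij => /eqP ->; rewrite ltnn.
- by move=> i j ij; rewrite -trmx_mul mxE lu_invL_mul.
move=> k x km hx; have hs := nb_le hnb (ltnW km).
(* Subtracting [x] removes the identity diagonal block, so [z] lives in the blocks before [k] and
   coercivity at [nb k] applies. *)
pose z := W^T *m x - x.
have hz : nsq z <= g2 * C2 * nsq x.
  apply: (le_trans (coercive_supp hs (coMT (ltnW km)) _)) => [i hi|].
    rewrite !mxE -[X in _ - X](_ : \sum_j (j == i)%:R * x j ord0 = _); last first.
      rewrite (bigD1 i)//= eqxx mul1r big1 ?addr0// => j /negbTE ->.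
      by rewrite mul0r.
    apply/eqP; rewrite subr_eq0; apply/eqP/eq_bigr => j _.
    have [jk|jk] := eqVneq (b j) k; last by rewrite hx ?mulr0.
    congr (_ * _); rewrite mxE lu_invL_lower_unit//.
    by rewrite jk leqNgt (blk_ltE hnb (ltnW km) (ltn_ord i)) -leqNgt.
  rewrite -mulrA; apply: ler_wpM2l; first exact: ltW.
  (* The first [k] block rows of [M^T *m W^T] vanish on block column [k], leaving only the
     contribution of [- x]. *)
  suff -> : (J k)^T *m (M^T *m z) = - ((J k)^T *m (M^T *m x)).
    rewrite -scaleN1r nsqZ sqrrN expr1n mul1r.
    exact: le_trans (nsq_emb_tr hs _) (sqbound_tr C0 boundM _).
  rewrite /z !mulmxBr [M^T *m (W^T *m x)]mulmxA -trmx_mul -[RHS]add0r; congr (_ - _).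
  apply/colP => i; rewrite (emb_trM hs) [RHS]mxE.
  apply: (block_lower_supp (m := m) (nb := nb) (k := k)).
  - by move=> r j rj; rewrite mxE lu_invL_mul.
  - by move=> j jk; apply: hx; rewrite neq_ltn jk.
  - by rewrite (blk_ltE hnb (ltnW km) (ltn_ord _)) /=; exact: ltn_ord.
have -> : W^T *m x = z + x by rewrite subrK.
have := nsq_ge0 (z - x); have := parallelogram z x; lra.
Qed.

End BlockLU.

(** * From dyadic growth to a power of [m], and the final constants *)

Section MainTheorem.
Set Implicit Arguments. Unset Strict Implicit.
Variable R : realType.

(** [theta ^ l = (2 ^ l) ^ a <= m ^ a]; the extra factor [theta <= 2] from rounding up to [l.+1]
    goes into the constant, and the square root halves the exponent. *)
Lemma specnorm_powR a c (n : nat) (A : 'M[R]_n) (m l : nat) (theta : R) :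
  0 <= c -> 0 <= theta -> theta <= 2 -> theta = 2 `^ a -> 0 <= a ->
  (2 ^ l <= m)%N -> sqbound A (theta ^+ l.+1 * c) ->
  specnorm A <= Num.sqrt (2 * c) * m%:R `^ (a / 2).
Proof.
move=> c0 t0 t2 ta a0 lm hA; apply: specnorm_le.
  by rewrite mulr_ge0 ?sqrtr_ge0 ?powR_ge0.
move=> x; apply: (le_trans (hA x)); apply: ler_wpM2r; first exact: nsq_ge0.
rewrite exprMn sqr_sqrtr ?mulr_ge0// exprS.
have -> : (m%:R `^ (a / 2)) ^+ 2 = (m%:R : R) `^ a.
  by rewrite -powR_mulrn ?powR_ge0// -powRrM divfK ?pnatr_eq0.
have h : theta ^+ l <= m%:R `^ a.
  rewrite ta -powR_mulrn ?powR_ge0// -powRrM mulrC powRrM powR_mulrn//.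
  by apply: ge0_ler_powR; rewrite ?nnegrE ?exprn_ge0// -natrX ler_nat.
by rewrite mulrAC ler_pM ?mulr_ge0 ?exprn_ge0// ler_wpM2r.
Qed.

End MainTheorem.

Theorem mainTheorem12 (R : realType) (C gamma : R) (hC : 0 < C) (hg : 0 < gamma) :
  exists (CLU p : R), 0 < CLU /\ 2 < p /\
  forall (n m : nat) (nb : nat -> nat) (M : 'M[R]_n),
    block_structure n m nb ->
    specnorm M <= C ->
    (forall j : nat, (j < m)%N ->
       leadmx (nb j.+1) M \in unitmx /\
       specnorm (invmx (leadmx (nb j.+1) M)) <= gamma^-1) ->
    exists L U : 'M[R]_n,
      [/\ M = L *m U, block_lower_unit m nb L, block_upper m nb U,
          L \in unitmx & U \in unitmx] /\
          specnorm L + specnorm U + specnorm (invmx L) + specnorm (invmx U)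
            <= CLU * powR (m%:R) p^-1.
Proof.
pose C2 := C ^+ 2; pose g2 := gamma^-1 ^+ 2.
have C20 : 0 < C2 by rewrite exprn_gt0.
have g20 : 0 < g2 by rewrite exprn_gt0 ?invr_gt0.
have p0 := mulr_gt0 g20 C20.
pose theta := 2 - (3 * (g2 * C2) + 2)^-1.
have N0 : 0 < (3 * (g2 * C2) + 2)^-1 by rewrite invr_gt0; lra.
have N1 : (3 * (g2 * C2) + 2)^-1 < 1 by rewrite invf_lt1; lra.
have t1 : 1 < theta by rewrite /theta; lra.
have t2 : theta < 2 by rewrite /theta; lra.
have l20 : 0 < ln (2 : R) by rewrite ln_gt0 ?ltr1n.
have lt0 : 0 < ln theta by rewrite ln_gt0.
pose a := ln theta / ln 2.
have a0 : 0 < a by rewrite divr_gt0.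
have a1 : a < 1 by rewrite ltr_pdivrMr// mul1r ltr_ln ?posrE//; lra.
have ta : theta = 2 `^ a.
  by rewrite /powR pnatr_eq0 /= /a divfK ?gt_eqF// lnK ?posrE//; lra.
pose kV := Num.sqrt (2 * g2); pose kW := Num.sqrt (2 * (2 * (1 + g2 * C2))).
(* [kV] and [kW] serve [U^-1 = V] and [L^-1 = W]; [L = M V] and [U = W M] cost a further factor [C]
   each. As [a < 1], [2 / a] exceeds 2. *)
exists ((1 + C) * (kV + kW)), (2 / a); split; [|split].
- by rewrite mulr_gt0 ?addr_gt0// sqrtr_gt0; lra.
- by rewrite ltr_pdivlMr//; lra.
move=> n m nb M hnb hM hI; rewrite invf_div.
have hlead k : (k <= m)%N ->
    (emb R n (nb k))^T *m M *m emb R n (nb k) \in unitmx /\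
    sqbound (invmx ((emb R n (nb k))^T *m M *m emb R n (nb k))) g2.
  move=> km; rewrite -(leadmx_emb (nb_le hnb km)).
  (* The hypothesis covers only nonempty leading blocks; for [k = 0] the matrix is empty, with
     determinant 1. *)
  case: k km => [_|k km]; last first.
    by have [hu hs] := hI _ km; split=> //; exact: sqbound_specnorm.
  have [-> _] := hnb; split; first by rewrite unitmxE det_mx00 unitr1.
  by move=> x; rewrite !nsq_col0 mulr0.
have unitM k (km : (k <= m)%N) := proj1 (hlead k km).
have boundI k (km : (k <= m)%N) := proj2 (hlead k km).
have boundM := sqbound_specnorm hM.
pose V := lu_invU m nb M; pose W := lu_invL m nb M.
(* For square matrices the product can be rotated cyclically: [M V] and [W M] are invertible with
   inverses [W] and [V], and multiply to [M]. *)
have e1 : W *m M *m V = 1%:M := lu_invL_invU hnb unitM.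
have e2 : V *m (W *m M) = 1%:M := mulmx1C e1.
have e3 : M *m V *m W = 1%:M by apply: mulmx1C; rewrite mulmxA.
have [uL uL'] := mulmx1_unit e3; have [uV uU] := mulmx1_unit e2.
have iL : invmx (M *m V) = W by rewrite -[RHS]mul1mx -(mulVmx uL) -mulmxA e3 mulmx1.
have iU : invmx (W *m M) = V by rewrite -[RHS]mul1mx -(mulVmx uU) -mulmxA e1 mulmx1.
exists (M *m V), (W *m M); split; first split => //.
- by rewrite -mulmxA e2 mulmx1.
- move=> i j; split=> ij; last by rewrite (mul_lu_invU hnb unitM) ?ij.
  rewrite (mul_lu_invU hnb unitM) 1?ltnW//.
  by rewrite (_ : i == j = false)//; apply: contraTF ij => /eqP ->; rewrite ltnn.
- by move=> i j ij; exact: lu_invL_mul.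
rewrite iL iU.
(* With [m = 0] all matrices are empty, and [0] to the nonzero power [a / 2] is [0]. *)
case: (posnP m) => [m0|m0].
  have n0 : n = 0%N by have [nb0 [<- _]] := hnb; rewrite m0.
  have z (A : 'M[R]_n) : specnorm A <= 0.
    by apply: specnorm_le => // x; clear -n0; subst n; rewrite !nsq_col0 mulr0.
  rewrite m0 powR0 ?mulr0 ?mulf_neq0 ?gt_eqF ?invr_gt0//.
  have := z (M *m V); have := z (W *m M); have := z W; have := z V; lra.
(* For [l] the integer part of [log2 m], [2 ^ l <= m < 2 ^ l.+1]; the dyadic bounds are used at
   level [l.+1]. *)
have [l1 l2] := (trunc_logP (isT : (1 < 2)%N) m0, trunc_log_ltn m (isT : (1 < 2)%N)).
set l := trunc_log 2 m in l1 l2.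
have bV := lu_invU_bound hnb unitM C20 g20 boundM boundI (ltnW l2).
have bW := lu_invL_bound hnb unitM C20 g20 boundM boundI (ltnW l2).
have t0 : 0 <= theta by lra.
set q := m%:R `^ (a / 2); have q0 : 0 <= q := powR_ge0 _ _.
have hV : specnorm V <= kV * q.
  by apply: (specnorm_powR (theta := theta)) l1 bV => //; lra.
have hW : specnorm W <= kW * q.
  by apply: (specnorm_powR (theta := theta)) l1 bW => //; lra.
have hL : specnorm (M *m V) <= C * (kV * q).
  exact: specnormM.
have hU : specnorm (W *m M) <= kW * q * C.
  exact: specnormM.
by lra.
Qed.
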